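(* Let $\lambda>0$, $q\ge 0$, and let $h(\lambda,q)>0$ be a function satisfying $\lim_{q\to 1}h(\lambda,q)=1$ and $\lim_{\lambda\to\infty}\frac{h(\lambda,q)}{\lambda^{1-q}}=1$. Let $X$ be a discrete random variable with $n$ values and probabilities $p(x_1),\dots,p(x_n)$ ($p(x_i)\ge 0$, $\sum_{i=1}^n p(x_i)=1$), and let $U$ be a random variable with $n$ values that is uniformly distributed (all probabilities equal $1/n$). Then the Tsallis hypoentropy satisfies $$0\le H_{\lambda,q}(X)\le H_{\lambda,q}(U).$$ The equality in the first inequality holds if and only if $p(x_j)=1$ for some $j$ (then $p(x_i)=0$ for all $i\ne j$). The equality in the second inequality holds if and only if $p(x_i)=1/n$ for all $i=1,\dots,n$.
   Context: The $q$-logarithm is $\ln_q(x)=\frac{x^{1-q}-1}{1-q}$ for $x>0$, $q\neq 1$, with $\ln_1=\log$ (the limit $q\to1$). For $\lambda>0$ and $q\ge 0$, the Tsallis hypoentropy of a random variable $X$ with probabilities $p(x_1),\dots,p(x_n)$ is $$H_{\lambda,q}(X)=\frac{h(\lambda,q)}{\lambda}\left\{-(1+\lambda)\ln_q\frac{1}{1+\lambda}+\sum_{i=1}^n(1+\lambda p(x_i))\ln_q\frac{1}{1+\lambda p(x_i)}\right\}.$$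
   Formalization: The ''only if'' parts of the two equality conditions are stated only for q > 0, since at q = 0 the Tsallis hypoentropy is zero for every X; the inequalities and the ''if'' parts are stated for all q ≥ 0. *)

(* Defs.v *)
From HB Require Import structures.
From mathcomp Require Import all_boot all_order all_algebra.
From mathcomp Require Import all_classical all_reals all_analysis.

Set Implicit Arguments.
Unset Strict Implicit.
Unset Printing Implicit Defensive.

Import Order.TTheory GRing.Theory Num.Theory.
Import numFieldNormedType.Exports.

Local Open Scope ring_scope.

(* Meaningful for 0 < x only. *)
Definition lnq (R : realType) (q x : R) : R :=
  if q == 1 then ln x else (x `^ (1 - q) - 1) / (1 - q).

(* The random variable enters only through its probabilities
   p i = P(X = x_i), i < n. *)
Definition tsallis_hypoentropy (R : realType) (h : R -> R -> R) (l q : R)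
    (n : nat) (p : 'I_n -> R) : R :=
  h l q / l * (- (1 + l) * lnq q (1 / (1 + l))
               + \sum_(i < n) (1 + l * p i) * lnq q (1 / (1 + l * p i))).

Definition prob_vector (R : realType) (n : nat) (p : 'I_n -> R) : Prop :=
  (forall i, 0 <= p i) /\ \sum_(i < n) p i = 1.

(* Main.v *)
(* With phi(y) = y ln_q(1/y), that is -y log y for q = 1 and (y^q - y)/(1 - q)
   otherwise, and f(t) = phi(1 + l t), the hypoentropy is the positive multiple
   h/l of sum_i f(p_i) - f(1), where f(0) = 0.  For q > 0 the function phi is
   strictly concave: by homogeneity, that it lies strictly below its tangents
   is Bernoulli's inequality for s^q.  The lower bound compares f with its chord
   over [0, 1], the upper bound with its tangent at 1/n.  For q = 0, f is linear
   and the hypoentropy vanishes. *)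
Require Import Defs.
From HB Require Import structures.
From mathcomp Require Import all_boot all_order all_algebra.
From mathcomp Require Import all_classical all_reals all_analysis.
From mathcomp Require Import ring lra.
Import Order.TTheory GRing.Theory Num.Theory.
Import numFieldNormedType.Exports.
Local Open Scope classical_set_scope.
Local Open Scope ring_scope.

Lemma ln_lt_sub1 {R : realType} (x : R) : 0 < x -> x != 1 -> ln x < x - 1.
Proof.
move=> x0 x1.
have /expR_gt1Dx : ln x != 0 by rewrite ln_eq0.
by rewrite lnK ?posrE// -ltrBrDl.
Qed.

(** Strict weighted AM-GM for [s] and [1] with weights [q] and [1 - q]: [v] is their arithmetic mean
    and [s != 1] forces [s != v]. *)
Lemma powR_lt_bernoulli {R : realType} (q s : R) :
  0 < q < 1 -> 0 < s -> s != 1 -> s `^ q < 1 + q * (s - 1).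
Proof.
move=> /andP[q0 q1] s0 s1; set v := 1 + _.
have v0 : 0 < v by rewrite /v; nra.
(* ln (s / v) and ln (1 / v), weighted by q and 1 - q *)
have sv : ln (s / v) < s / v - 1.
  apply: ln_lt_sub1; first exact: divr_gt0.
  apply: contra s1 => /eqP sv1; have : s = v by rewrite -[v]mul1r -sv1 divfK ?gt_eqF.
  by rewrite /v => svE; apply/eqP; nra.
have v1 : ln v^-1 <= v^-1 - 1.
  have := @le_ln1Dx R (v^-1 - 1); rewrite [1 + _]addrC subrK; apply.
  by rewrite ltrBrDl subrr invr_gt0.
rewrite -ltr_ln ?posrE ?powR_gt0// ln_powR.
move: sv v1; rewrite ln_div ?posrE// lnV ?posrE// => sv v1.
(* The bounds cancel because [q * s + (1 - q) = v]. *)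
have vE : q * (s / v - 1) + (1 - q) * (v^-1 - 1) = 0.
  by have v_neq0 := lt0r_neq0 v0; move: v_neq0; rewrite /v => ?; field.
have : q * (ln s - ln v) < q * (s / v - 1) by rewrite ltr_pM2l.
have : (1 - q) * (- ln v) <= (1 - q) * (v^-1 - 1) by rewrite ler_pM2l ?subr_gt0.
lra.
Qed.

Lemma powR_gt_bernoulli {R : realType} (q s : R) :
  1 < q -> 0 < s -> s != 1 -> 1 + q * (s - 1) < s `^ q.
Proof.
move=> q1 s0 s1; have q0 : 0 < q by lra.
have sq1 : s `^ q != 1 by rewrite powR_eq1 !negb_or s1 (gt_eqF q0) -leNgt ltW.
have := powR_lt_bernoulli q^-1 (s `^ q).
rewrite invr_gt0 q0 invf_lt1// q1 => /(_ isT (powR_gt0 _ s0) sq1).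
rewrite -powRrM mulfV ?gt_eqF// powRr1 ?ltW// -ltrBlDl mulrC ltr_pdivlMr//.
by move=> ?; lra.
Qed.

Lemma mul_lnqV {R : realType} (q y : R) : q != 1 -> 0 < y ->
  y * lnq q (1 / y) = (y `^ q - y) / (1 - q).
Proof.
move=> q1 y0; rewrite /lnq (negbTE q1) mulrA; congr (_ / _).
rewrite div1r -powR_inv1 ?ltW// -powRrM mulN1r opprB mulrBr mulr1.
congr (_ - _); rewrite -{1}[y]powRr1 ?ltW// -powRD ?(gt_eqF y0) ?implybT//.
by congr (_ `^ _); lra.
Qed.

Lemma mul_ln1V {R : realType} (y : R) : 0 < y -> y * lnq 1 (1 / y) = - (y * ln y).
Proof. by move=> y0; rewrite /lnq eqxx div1r lnV ?posrE// mulrN. Qed.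

Lemma mul_lnqV_lt_tangent {R : realType} (q a : R) : 0 < q -> 0 < a ->
  exists d, forall y, 0 < y -> y != a ->
    y * lnq q (1 / y) < a * lnq q (1 / a) + d * (y - a).
Proof.
move=> q0 a0; have [->|q1] := eqVneq q 1.
  (* The slope is the derivative of [- (y * ln y)] at [a]; the claim reduces to
     [y * ln (a / y) < a - y]. *)
  exists (- (ln a + 1)) => y y0 ya; rewrite !mul_ln1V//.
  have lt_ay : ln (a / y) < a / y - 1.
    apply: ln_lt_sub1; first exact: divr_gt0.
    apply: contra ya => /eqP ay; apply/eqP.
    by rewrite -[y]mul1r -ay divfK ?gt_eqF.
  have : y * ln (a / y) < y * (a / y - 1) by rewrite ltr_pM2l.
  rewrite mulrBr [y * (a / y)]mulrC divfK ?gt_eqF//.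
  by rewrite ln_div ?posrE// => ?; lra.
exists ((q * (a `^ q / a) - 1) / (1 - q)) => y y0 ya; rewrite !mul_lnqV//.
pose s := y / a; have s0 : 0 < s by exact: divr_gt0.
have yE : y = s * a by rewrite divfK ?gt_eqF.
have s1 : s != 1 by apply: contra ya => /eqP s1; rewrite yE s1 mul1r.
rewrite yE powRM ?ltW// -subr_gt0.
have qB : 1 - q != 0 by rewrite subr_eq0 eq_sym.
(* The gap below the tangent is a Bernoulli gap over [1 - q]; both change sign at [q = 1], so the
   quotient stays positive. *)
rewrite [ltRHS](_ : _ = a `^ q * ((1 + q * (s - 1) - s `^ q) / (1 - q))); last first.
  by field; rewrite qB gt_eqF.
apply: mulr_gt0; first exact: powR_gt0.
have [ql|qg|/eqP] := ltgtP q 1; last by rewrite (negbTE q1).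
  by rewrite divr_gt0 ?subr_gt0// powR_lt_bernoulli ?q0.
by rewrite -mulrNN -invrN !opprB divr_gt0 ?subr_gt0// powR_gt_bernoulli.
Qed.

Lemma tsallis_hypoentropyE {R : realType} (h : R -> R -> R) (l q : R)
    (n : nat) (p : 'I_n -> R) (f := fun t => (1 + l * t) * lnq q (1 / (1 + l * t))) :
  tsallis_hypoentropy h l q p = h l q / l * (\sum_(i < n) f (p i) - f 1).
Proof. by rewrite /tsallis_hypoentropy /f mulNr !mulr1 addrC. Qed.

Lemma prob_vector_le1 {R : realType} (n : nat) (p : 'I_n -> R) (i : 'I_n) :
  prob_vector p -> p i <= 1.
Proof.
case=> p0 <-; rewrite (bigD1 i)//= lerDl.
by apply: sumr_ge0 => j _; exact: p0.
Qed.

Lemma prob_vector_eq1 {R : realType} (n : nat) (p : 'I_n -> R) (j : 'I_n) :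
  prob_vector p -> p j = 1 -> forall i, i != j -> p i = 0.
Proof.
case=> p0 p1 pj i ij; move: p1; rewrite (bigD1 j)//= pj => /eqP.
rewrite -subr_eq0 addrAC subrr add0r psumr_eq0 => [/allP/(_ i)|k _]; last exact: p0.
by rewrite mem_index_enum ij => /(_ isT)/eqP.
Qed.

Lemma prob_vector_size_neq0 {R : realType} (n : nat) (p : 'I_n -> R) :
  prob_vector p -> n%:R != 0 :> R.
Proof.
case: n p => [p [_ /eqP]|n p _]; last by rewrite pnatr_eq0.
by rewrite big_ord0 eq_sym oner_eq0.
Qed.

(** Strict concavity on the nonnegative reals, phrased with supporting lines so that no derivative
    is involved. *)
Definition strictly_below_tangents {R : realType} (f : R -> R) : Prop :=
  forall t, 0 <= t -> exists d,
    forall x, 0 <= x -> x != t -> f x < f t + d * (x - t).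

(** For [0 < t < 1], evaluate the tangent at [t] at the points [0] and [1] and weight by [1 - t] and
    [t]: the slope terms cancel. *)
Lemma below_tangents_chord {R : realType} (f : R -> R) (t : R) :
  strictly_below_tangents f -> f 0 = 0 -> 0 <= t <= 1 ->
  t * f 1 <= f t ?= iff (t == 0) || (t == 1).
Proof.
move=> ftan f0 /andP[t0 t1].
have [->|tn0] := eqVneq t 0; first by rewrite f0 mul0r /=; exact/leif_refl.
have [->|tn1] /= := eqVneq t 1; first by rewrite mul1r; exact/leif_refl.
have {}t0 : 0 < t by rewrite lt_def tn0.
have {}t1 : t < 1 by rewrite lt_def eq_sym tn1.
suff lt_f : t * f 1 < f t by split; [exact: ltW|rewrite lt_eqF].
have [d fd] := ftan t (ltW t0).
have := fd 0 (lexx _); rewrite eq_sym tn0 f0 => /(_ isT) d0.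
have := fd 1 ler01; rewrite eq_sym tn1 => /(_ isT) d1.
have : t * f 1 < t * (f t + d * (1 - t)) by rewrite ltr_pM2l.
have : (1 - t) * 0 < (1 - t) * (f t + d * (0 - t)) by rewrite ltr_pM2l ?subr_gt0.
by lra.
Qed.

(** Sum the chord bounds, using that the [p i] add up to [1]. Equality makes every [p i] equal to
    [0] or [1], and they cannot all be [0]. *)
Lemma leif_sum_deterministic {R : realType} (f : R -> R) (n : nat) (p : 'I_n -> R) :
  strictly_below_tangents f -> f 0 = 0 -> prob_vector p ->
  f 1 <= \sum_(i < n) f (p i) ?= iff [exists j, p j == 1].
Proof.
move=> ftan f0 pP; have [p0 p1] := pP.
have fge i : xpredT i -> p i * f 1 <= f (p i) ?= iff (p i == 0) || (p i == 1).
  by move=> _; apply: below_tangents_chord; rewrite ?p0 ?prob_vector_le1.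
have := leif_sum fge; rewrite -mulr_suml p1 mul1r; congr (_ <= _ ?= iff _).
apply/forallP/existsP => [p01|[j /eqP pj] i /=]; last first.
  have [->|ij] := eqVneq i j; first by rewrite pj eqxx orbT.
  by rewrite (prob_vector_eq1 n p j pP pj i ij) eqxx.
apply/existsP; apply: contraT => /existsPn pn1; move: p1.
rewrite big1 => [/eqP|i _]; first by rewrite eq_sym oner_eq0.
by have := p01 i; rewrite (negbTE (pn1 i)) orbF => /eqP.
Qed.

(** Sum the bounds by the single tangent at [1 / n%:R]: the deviations [p i - 1 / n%:R] add up to
    [0], so the slope drops out, and equality holds only termwise. *)
Lemma leif_sum_uniform {R : realType} (f : R -> R) (n : nat) (p : 'I_n -> R) :
  strictly_below_tangents f -> prob_vector p ->
  \sum_(i < n) f (p i) <= \sum_(i < n) f (1 / n%:R) ?= iff [forall i, p i == 1 / n%:R].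
Proof.
move=> ftan pP; have [p0 p1] := pP.
have n0 := prob_vector_size_neq0 n p pP.
have [d fd] := ftan (1 / n%:R) (divr_ge0 ler01 (ler0n _ _)).
have fle i : xpredT i ->
    f (p i) <= f (1 / n%:R) + d * (p i - 1 / n%:R) ?= iff (p i == 1 / n%:R).
  move=> _; have [->|pi] := eqVneq (p i) (1 / n%:R).
    by rewrite subrr mulr0 addr0; exact/leif_refl.
  by have lt_f := fd _ (p0 i) pi; split; [exact: ltW|rewrite lt_eqF].
have := leif_sum fle; rewrite big_split/= -mulr_sumr sumrB p1.
by rewrite !sumr_const !card_ord -(mulr_natr (1 / n%:R)) divfK// subrr mulr0 addr0.
Qed.

Lemma tsallis_hypoentropy_q0 {R : realType} (h : R -> R -> R) (l : R)
    (n : nat) (p : 'I_n -> R) :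
  0 < l -> prob_vector p -> tsallis_hypoentropy h l 0 p = 0.
Proof.
move=> l0 [p0 p1]; rewrite tsallis_hypoentropyE.
have fE t : 0 <= t -> (1 + l * t) * lnq 0 (1 / (1 + l * t)) = - l * t.
  (* At [q = 0] the power is constantly [1], leaving [1 - (1 + l * t)]. *)
  move=> t0; rewrite mul_lnqV ?powRr0 1?eq_sym ?oner_eq0//; first by field.
  by rewrite ltr_pwDl// mulr_ge0// ltW.
rewrite (eq_bigr (fun i => - l * p i)) => [|i _]; last exact: fE.
by rewrite -mulr_sumr p1 fE// subrr mulr0.
Qed.

(* At q = 0 the hypoentropy vanishes identically, so the "only if" halves of
   the equality cases are stated for 0 < q. *)
Theorem proposition3p6 (R : realType) (h : R -> R -> R)
    (h_gt0 : forall l q : R, 0 < l -> 0 <= q -> 0 < h l q)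
    (h_q1 : forall l : R, 0 < l -> h l q @[q --> (1 : R)^'] --> (1 : R))
    (h_linfty : forall q : R, 0 <= q ->
       h l q / l `^ (1 - q) @[l --> +oo%R] --> (1 : R))
    (l q : R) (l_gt0 : 0 < l) (q_ge0 : 0 <= q)
    (n : nat) (p u : 'I_n -> R)
    (p_prob : prob_vector p)
    (u_unif : forall i, u i = 1 / n%:R) :
  [/\ 0 <= tsallis_hypoentropy h l q p
        <= tsallis_hypoentropy h l q u,
      ((exists j, p j = 1) -> 0 = tsallis_hypoentropy h l q p)
      /\ (0 < q -> 0 = tsallis_hypoentropy h l q p -> exists j, p j = 1),
      (forall j, p j = 1 -> forall i, i != j -> p i = 0)
    & ((forall i, p i = 1 / n%:R) ->
         tsallis_hypoentropy h l q p = tsallis_hypoentropy h l q u)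
      /\ (0 < q ->
          tsallis_hypoentropy h l q p = tsallis_hypoentropy h l q u ->
          forall i, p i = 1 / n%:R)].
Proof.
have uE : u = fun=> 1 / n%:R by exact/funext.
have n0 := prob_vector_size_neq0 n p p_prob.
have u_prob : prob_vector (fun _ : 'I_n => 1 / n%:R : R).
  split=> [i|]; first by rewrite divr_ge0.
  by rewrite sumr_const card_ord -(mulr_natr (1 / n%:R)) divfK.
have pj_eq0 := fun j => prob_vector_eq1 n p j p_prob.
rewrite uE; have [q_eq0|q_neq0] := eqVneq q 0.
  rewrite {}q_eq0 !tsallis_hypoentropy_q0// lexx.
  by split=> //; split=> //; rewrite ltxx.
have q_gt0 : 0 < q by rewrite lt_def q_neq0.
have c_gt0 : 0 < h l q / l by rewrite divr_gt0// h_gt0.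
rewrite !tsallis_hypoentropyE.
set f := fun t : R => (1 + l * t) * lnq q (1 / (1 + l * t)).
have f0 : f 0 = 0.
  by rewrite /f mulr0 addr0 divr1 mul1r /lnq ln1 powR1 subrr mul0r if_same.
have ftan : strictly_below_tangents f.
  move=> t t0; have lt_gt0 x : 0 <= x -> 0 < 1 + l * x.
    by move=> x0; rewrite ltr_pwDl// mulr_ge0// ltW.
  have [d dP] := mul_lnqV_lt_tangent q (1 + l * t) q_gt0 (lt_gt0 t t0).
  (* Chain rule for the affine substitution [y = 1 + l * x], which is injective since [l] is
     nonzero. *)
  exists (d * l) => x x0 xt; have := dP _ (lt_gt0 x x0).
  rewrite [d * l * _](_ : _ = d * (1 + l * x - (1 + l * t))); last by ring.
  by apply; apply: contra xt => /eqP/addrI/(mulfI (lt0r_neq0 l_gt0)) ->.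
have [lo loE] := leif_sum_deterministic f n p ftan f0 p_prob.
have [up upE] := leif_sum_uniform f n p ftan p_prob.
(* The positive factor [h l q / l] preserves both inequalities and cancels in both equality
   cases. *)
have c_neq0 := lt0r_neq0 c_gt0.
split=> //.
- by rewrite pmulr_rge0// subr_ge0 lo ler_pM2l// lerD2r.
- have loP : 0 = h l q / l * (\sum_(i < n) f (p i) - f 1) <-> exists j, p j = 1.
    split=> [/esym/eqP|[j pj]].
      rewrite mulf_eq0 (negbTE c_neq0)/= subr_eq0 eq_sym loE.
      by case/existsP => j /eqP ?; exists j.
    have /eqP <- : f 1 == \sum_(i < n) f (p i).
      by rewrite loE; apply/existsP; exists j; rewrite pj.
    by rewrite subrr mulr0.
  by split=> [|_]; apply loP.
- split=> [pu|_ /(mulfI c_neq0)/addIr/eqP]; last first.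
    by rewrite upE => /forallP pu i; exact/eqP.
  by congr (_ * (_ - _)); apply: eq_bigr => i _; rewrite pu.
Qed.
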